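(* Let $G$ be a group admitting a weakly acylindrical action on a simplicial tree $T$. Then $G$ has trivial positive theory, i.e. $G$ satisfies exactly the same positive sentences as a non-abelian free group.
   Context: A positive sentence in the language of groups is a first-order sentence without negations, i.e. of the form $\forall x_1\exists y_1\dots\forall x_n\exists y_n\ \bigvee_{i=1}^r\bigwedge_{j=1}^s \Sigma_{i,j}(x_1,y_1,\dots,x_n,y_n)=1$ with $\Sigma_{i,j}$ words in $F(x_1,y_1,\dots,x_n,y_n)$ (tuples of variables allowed). The positive theory $Th^+(G)$ is the set of positive sentences true in $G$; $G$ has trivial positive theory if $Th^+(G)=Th^+(F_2)$, where $F_2$ is the free group of rank 2. Let $G$ act on a simplicial tree $T$ without inversions and fix a vertex $v$. An $o$-geodesic is an oriented geodesic segment of $T$ both of whose endpoints lie in the orbit $G\cdot v$; its $o$-length $|J|_o$ is $\#(J\cap G\cdot v)-1$; $J^{op}$ denotes $J$ with the reverse orientation. Let $\mathcal E^{(n)}$ be the set of $o$-geodesics of $o$-length $n$. A labelling is a pair $(k,f)$ with $k$ a positive integer and $f:\mathcal E^{(k)}\to\{a,b,c\}$ a $G$-invariant map. It is good if $f^{-1}(a)$ and $f^{-1}(b)$ each consist of finitely many $G$-orbits and at least one of: (i) $f^{-1}(a)$ is a single $G$-orbit and $f^{-1}(b)$ is a single $G$-orbit; (ii) $f(J)=a$ implies $f(J^{op})\neq b$. For $N\ge k$ and $J\in\mathcal E^{(N)}$, let $J_1,\dots,J_{N-k+1}$ be the $o$-geodesics of $o$-length $k$ contained in $J$, with the orientation of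 $J$, ordered from left to right, and set $f^*(J)=f(J_1)f(J_2)\cdots f(J_{N-k+1})$, a word in $\{a,b,c\}$. For a finite sequence $\bar e=(e_1,\dots,e_q)$ of positive integers let $u_{\bar e}(a,b)=ab^{e_1}ab^{e_2}\cdots ab^{e_q}a$. A minimal action (no proper invariant subtree) of $G$ on a simplicial tree $T$ without inversions is weakly acylindrical if $T$ is not a line, the action admits a good labelling $(k,f)$, and for every finite sequence $\bar e$ of positive integers there exists an $o$-geodesic $J$ with $f^*(J)=u_{\bar e}(a,b)$. *)

(* Defs.v *)
From mathcomp Require Import all_boot all_algebra.
From Stdlib Require List.
Set Implicit Arguments. Unset Strict Implicit. Unset Printing Implicit Defensive.

Record gops := GOps {
  gcar :> Type;
  gmul : gcar -> gcar -> gcar;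
  gone : gcar;
  ginv : gcar -> gcar }.

Record is_group (M : gops) : Prop := {
  gmulA : forall x y z : M, gmul x (gmul y z) = gmul (gmul x y) z;
  gmul1 : forall x : M, gmul (gone M) x = x;
  gmulV : forall x : M, gmul (ginv x) x = gone M }.

(* A group word in the variables is a list of (variable, inverted?).   *)
Definition gword := seq (nat * bool)%type.

Inductive pform : Type :=
  | PEq  : gword -> pform
  | PAnd : pform -> pform -> pform
  | POr  : pform -> pform -> pform
  | PAll : nat -> pform -> pform
  | PEx  : nat -> pform -> pform.

Fixpoint fv (p : pform) : seq nat :=
  match p with
  | PEq w => map fst w
  | PAnd p q | POr p q => fv p ++ fv q
  | PAll x p | PEx x p => [seq y <- fv p | y != x]
  end.

Definition sentence (p : pform) : Prop := fv p = [::].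

Section Semantics.
Variable M : gops.

Definition eval_word (env : nat -> M) (w : gword) : M :=
  foldr (fun l acc => gmul (if l.2 then ginv (env l.1) else env l.1) acc)
        (gone M) w.

Definition upd (env : nat -> M) (x : nat) (g : M) : nat -> M :=
  fun y => if y == x then g else env y.

Fixpoint holds_env (env : nat -> M) (p : pform) : Prop :=
  match p with
  | PEq w => eval_word env w = gone M
  | PAnd p q => holds_env env p /\ holds_env env q
  | POr p q => holds_env env p \/ holds_env env q
  | PAll x p => forall g : M, holds_env (upd env x g) p
  | PEx x p => exists g : M, holds_env (upd env x g) p
  end.

(* truth of a sentence (the environment is irrelevant for sentences) *)
Definition holds (p : pform) : Prop := holds_env (fun _ => gone M) p.
End Semantics.

(* The free group F_2 on {a, b}: reduced words over the letters        *)
(* (generator, inverted?) with concatenate-and-reduce product.          *)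
Definition letter := (bool * bool)%type.
Definition linv (l : letter) : letter := (l.1, ~~ l.2).
Definition reduced (w : seq letter) : bool :=
  sorted (fun x y : letter => y != linv x) w.

Definition push (l : letter) (w : seq letter) : seq letter :=
  match w with
  | [::] => [:: l]
  | l' :: w' => if l' == linv l then w' else l :: w
  end.
Definition reduce (w : seq letter) : seq letter := foldr push [::] w.

Lemma reduced_push l w : reduced w -> reduced (push l w).
Proof.
case: w => [|l' w'] //= H.
case: ifP => E.
  by move: H; rewrite /reduced /=; apply: path_sorted.
by rewrite /reduced /= E.
Qed.

Lemma reduced_reduce w : reduced (reduce w).
Proof. by elim: w => [|l w IH] //=; apply: reduced_push. Qed.

Definition F2car := {w : seq letter | reduced w}.
Definition F2mul (u v : F2car) : F2car :=
  exist _ (reduce (proj1_sig u ++ proj1_sig v)) (reduced_reduce _).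
Definition F2one : F2car := exist _ [::] (reduced_reduce [::]).
Definition F2inv (u : F2car) : F2car :=
  exist _ (reduce (rev (map linv (proj1_sig u)))) (reduced_reduce _).
Definition F2 : gops := GOps F2mul F2one F2inv.

Definition trivial_positive_theory (M : gops) : Prop :=
  forall p : pform, sentence p -> (holds M p <-> holds F2 p).

Section Trees.
Variable V : Type.
Variable adj : V -> V -> Prop.

Fixpoint adj_path (x : V) (s : seq V) : Prop :=
  match s with
  | [::] => True
  | y :: s' => adj x y /\ adj_path y s'
  end.

Definition is_simplicial_tree : Prop :=
  (forall x, ~ adj x x) /\
  (forall x y, adj x y -> adj y x) /\
  (forall x y : V, exists s, adj_path x s /\ last x s = y) /\
  (forall (x : V) (s : seq V), 2 <= size s -> List.NoDup (x :: s) ->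
     adj_path x s -> ~ adj (last x s) x).

Definition is_line : Prop :=
  exists f : int -> V, bijective f /\
    forall i j : int, adj (f i) (f j) <-> (j = i + 1 \/ i = j + 1)%R.

(* geodesic segment as its (non-empty) list of vertices: an edge path
   without backtracking (in a tree these are exactly the geodesics) *)
Fixpoint nobacktrack (x y : V) (s : seq V) : Prop :=
  match s with
  | [::] => True
  | z :: s' => z <> x /\ nobacktrack y z s'
  end.

Definition geodesic (J : seq V) : Prop :=
  match J with
  | [::] => False
  | x :: s => adj_path x s /\
      match s with [::] => True | y :: s' => nobacktrack x y s' end
  end.
End Trees.

Section Action.
Variable M : gops.
Variable V : Type.
Variable adj : V -> V -> Prop.
Variable act : M -> V -> V.

Definition is_action_without_inversions : Prop :=
  (forall x, act (gone M) x = x) /\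
  (forall g h x, act (gmul g h) x = act g (act h x)) /\
  (forall g x y, adj x y <-> adj (act g x) (act g y)) /\
  (forall g x y, adj x y -> act g x = y -> act g y <> x).

Definition invariant_subtree (S : V -> Prop) : Prop :=
  (exists x, S x) /\
  (forall g x, S x -> S (act g x)) /\
  (forall x y, S x -> S y ->
     exists s, adj_path adj x s /\ last x s = y /\ forall z, List.In z s -> S z).

Definition minimal_action : Prop :=
  forall S : V -> Prop, invariant_subtree S -> forall x, S x.

Variable v0 : V.

Definition in_orbit (x : V) : Prop := exists g : M, act g v0 = x.

Definition orbit_pos (J : seq V) (s : seq nat) : Prop :=
  sorted ltn s /\
  forall i, i \in s <-> (i < size J /\ in_orbit (nth v0 J i)).

Definition o_geodesic (J : seq V) : Prop :=
  geodesic adj J /\ in_orbit (head v0 J) /\ in_orbit (last v0 J).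

Definition o_length (J : seq V) (n : nat) : Prop :=
  exists s, orbit_pos J s /\ size s = n.+1.

Definition E (n : nat) (J : seq V) : Prop := o_geodesic J /\ o_length J n.

Definition translate (g : M) (J : seq V) : seq V := map (act g) J.

Inductive lab := La | Lb | Lc.

Definition labelling (k : nat) (f : seq V -> lab) : Prop :=
  0 < k /\ forall g J, E k J -> f (translate g J) = f J.

Definition finitely_many_orbits (k : nat) (P : seq V -> Prop) : Prop :=
  exists L : seq (seq V),
    (forall J, List.In J L -> E k J /\ P J) /\
    (forall J, E k J -> P J -> exists J' g, List.In J' L /\ J = translate g J').

Definition single_orbit (k : nat) (P : seq V -> Prop) : Prop :=
  exists J0, E k J0 /\ P J0 /\
    forall J, E k J -> P J -> exists g, J = translate g J0.

Definition good_labelling (k : nat) (f : seq V -> lab) : Prop :=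
  labelling k f /\
  finitely_many_orbits k (fun J => f J = La) /\
  finitely_many_orbits k (fun J => f J = Lb) /\
  ( (single_orbit k (fun J => f J = La) /\ single_orbit k (fun J => f J = Lb))
    \/ (forall J, E k J -> f J = La -> f (rev J) <> Lb) ).

(* f^*(J) = w : the labels of the consecutive o-subgeodesics of o-length k *)
Definition fstar (k : nat) (f : seq V -> lab) (J : seq V) (w : seq lab) : Prop :=
  exists s, orbit_pos J s /\
    w = [seq f (take (nth 0 s (i + k) - nth 0 s i).+1 (drop (nth 0 s i) J))
        | i <- iota 0 (size s - k)].
End Action.

Definition u_word (e : seq nat) : seq lab :=
  La :: flatten [seq nseq n Lb ++ [:: La] | n <- e].

Definition weakly_acylindrical (M : gops) (V : Type) (adj : V -> V -> Prop)
    (act : M -> V -> V) : Prop :=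
  minimal_action adj act /\
  ~ is_line adj /\
  exists (v0 : V) (k : nat) (f : seq V -> lab),
    good_labelling adj act v0 k f /\
    forall e : seq nat, all (fun n => 0 < n) e ->
      exists (J : seq V) (N : nat),
        E adj act v0 N J /\ k <= N /\ fstar act v0 k f J (u_word e).

(* Main.v *)
Require Import Defs.
From mathcomp Require Import all_boot all_algebra.
From HB Require Import structures.
From mathcomp Require Import boolp zify.
From Stdlib Require List Permutation.
Set Implicit Arguments. Unset Strict Implicit. Unset Printing Implicit Defensive.

(** Merzlyakov's argument, run as a transfer of truth from [G] to an arbitrary
    group [H]. Fix finitely many exponents [e] with values [h_e] in [H], and
    send [g] to the product in [H] of [h_e] (resp. its inverse) over the
    occurrences, in the labels of the geodesic from [v] to [g v] (resp. from
    [g v] to [v]), of the word [a b^e a b^(e+1) a]. For a given product [g h]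
    this map is multiplicative unless one of these words straddles the centre of
    the tripod spanned by [v], [g v] and [g h v], and a centre spoils at most a
    constant number of exponents. To answer a universal quantifier over [H],
    play in [G] an element labelled [a b^s a b^(s+1) a ...] with [s] large and
    with more exponents than the formula can spoil: for a surviving exponent [e]
    its image is [u h_e w] with [u] and [w] independent of [h_e], and it takes
    any prescribed value for a suitable [h_e]. This gives both inclusions of
    positive theories, because [F_2] acting on its Cayley tree has the same
    structure. *)

(** * Consequences of the left-sided group axioms *)

Section GroupLaws.
Variables (M : gops) (gM : is_group M).
Implicit Types x y z : M.
Local Notation "x * y" := (gmul x y).
Local Notation "x ^-1" := (ginv x).
Local Notation "1" := (gone M).

Lemma gmulKV x y : x^-1 * (x * y) = y.
Proof. by rewrite (gmulA gM) (gmulV gM) (gmul1 gM). Qed.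

Lemma gmulVr x : x * x^-1 = 1.
Proof. by rewrite -(gmulKV x^-1 (x * x^-1)) (gmulKV x) (gmulV gM). Qed.

Lemma gmulK x y : x * (x^-1 * y) = y.
Proof. by rewrite (gmulA gM) gmulVr (gmul1 gM). Qed.

Lemma gmul1r x : x * 1 = x.
Proof. by rewrite -(gmulV gM x) gmulK. Qed.

Lemma ginv_uniq x y : x * y = 1 -> y = x^-1.
Proof. by move=> xy1; rewrite -(gmulKV x y) xy1 gmul1r. Qed.

Lemma ginvK x : x^-1^-1 = x.
Proof. by symmetry; apply: ginv_uniq; apply: (gmulV gM). Qed.

Lemma ginv1 : 1^-1 = 1.
Proof. by symmetry; apply: ginv_uniq; apply: (gmul1 gM). Qed.

Lemma ginvM x y : (x * y)^-1 = y^-1 * x^-1.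
Proof. by symmetry; apply: ginv_uniq; rewrite -(gmulA gM) gmulK gmulVr. Qed.

End GroupLaws.

(** * Words in the labels *)

Definition eq_lab (x y : lab) : bool :=
  match x, y with La, La | Lb, Lb | Lc, Lc => true | _, _ => false end.

Lemma eq_labP : Equality.axiom eq_lab.
Proof. by do 2!case; constructor. Qed.

HB.instance Definition _ := hasDecEq.Build lab eq_labP.

(* With a single run of [Lb]'s the mark would be a palindrome, and a labelling
   insensitive to orientation would show it in both directions at once. *)
Definition mark (e : nat) : seq lab :=
  La :: nseq e Lb ++ La :: nseq e.+1 Lb ++ [:: La].

Lemma size_mark e : size (mark e) = (e.*2 + 4)%N.
Proof. by rewrite /= !(size_cat, size_nseq) /= size_cat size_nseq /=; lia. Qed.

Definition run (w : seq lab) : nat := find (predC1 Lb) w.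

Lemma run_nseq n w : run (nseq n Lb ++ La :: w) = n.
Proof. by elim: n => //= n IHn; rewrite -[in RHS]IHn. Qed.

Lemma prefix_nseq_La m n x w :
  prefix (nseq m Lb ++ La :: x) (nseq n Lb ++ La :: w) = (m == n) && prefix x w.
Proof. by elim: m n => [|m IHm] [|n] //=; rewrite eqxx eqSS IHm. Qed.

(** Meant for labels [a] of windows and [b] of their reversals, with [c] the blank label [Lc]: [phi]
    relates the two only where neither is blank, hence the two [all] hypotheses. *)
Lemma prefix_map_rel (T : eqType) (phi : T -> T) (U : Type) (a b : U -> T) c S l :
  prefix S (map b l) -> all (predC1 c) S -> all (predC1 c) (map a l) ->
  (forall x, a x != c -> b x != c -> a x = phi (b x)) ->
  prefix (map phi S) (map a l).
Proof.
move=> + + + ab; elim: S l => [|x S IHS] [|y l] //=.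
move=> /andP[/eqP-> pr] /andP[by_ allS] /andP[ay all_a].
by rewrite (ab _ ay by_) eqxx IHS.
Qed.

Lemma prefix_size_drop (T : eqType) (s w : seq T) i :
  0 < size s -> prefix s (drop i w) -> i < size w.
Proof.
by move=> s_gt0 /size_prefix; rewrite size_drop; lia.
Qed.

Definition u_tail (es : seq nat) : seq lab := flatten [seq nseq n Lb ++ [:: La] | n <- es].

Lemma u_tail_cons e es : u_tail (e :: es) = nseq e Lb ++ La :: u_tail es.
Proof. by rewrite /u_tail /= -catA. Qed.

Lemma u_word_cons e es : u_word (e :: es) = La :: nseq e Lb ++ u_word es.
Proof. by rewrite /u_word /= -catA. Qed.

Lemma all_u_word es : all (predC1 Lc) (u_word es).
Proof.
elim: es => // e es IHes; rewrite u_word_cons /= all_cat IHes andbT.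
by rewrite all_nseq orbT.
Qed.

Lemma prefix_mark_u_word e s es :
  prefix (mark e) (La :: nseq s Lb ++ u_word es) =
  (e == s) && prefix (nseq e.+1 Lb ++ [:: La]) (u_tail es).
Proof. by rewrite /mark prefix_cons eqxx prefix_nseq_La. Qed.

(** Marks and their reversals begin with [La], so in the middle case none of them can start at [i];
    the last case feeds an induction on the blocks. *)
Lemma drop_runP s i (w : seq lab) :
  [\/ i = 0, (exists r, drop i (La :: nseq s Lb ++ w) = Lb :: r)
    | exists2 j, i = (s.+1 + j)%N & drop i (La :: nseq s Lb ++ w) = drop j w].
Proof.
case: i => [|i]; first by constructor 1.
case: (ltnP i s) => si; [constructor 2|constructor 3].
  exists (nseq (s - i).-1 Lb ++ w) => /=.
  by rewrite drop_cat size_nseq si drop_nseq; case: (s - i) (subn_gt0 i s) => //; rewrite si.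
exists (i - s)%N; first lia.
by rewrite /= drop_cat size_nseq ltnNge si.
Qed.

Lemma mark_ge e s q i : prefix (mark e) (drop i (u_word (iota s q))) -> s <= e.
Proof.
elim: q s i => [|q IHq] s i.
  by move/size_prefix; rewrite size_mark size_drop /=; lia.
rewrite [iota _ _]/= u_word_cons.
case: (drop_runP s i (u_word (iota s.+1 q))) => [->|[r' ->//]|[j _ ->]].
  by rewrite drop0 prefix_mark_u_word => /andP[/eqP->].
by move/IHq/ltnW.
Qed.

(** The runs have lengths [s], [s+1], and so on: a mark at the head has exponent [s], while by
    [mark_ge] one further on has a larger exponent. *)
Lemma mark_uniq e s q i j : prefix (mark e) (drop i (u_word (iota s q))) ->
  prefix (mark e) (drop j (u_word (iota s q))) -> i = j.
Proof.
elim: q s i j => [|q IHq] s i j.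
  by move/size_prefix; rewrite size_mark size_drop /=; lia.
rewrite [iota _ _]/= u_word_cons.
have H0 : prefix (mark e) (La :: nseq s Lb ++ u_word (iota s.+1 q)) -> e = s.
  by rewrite prefix_mark_u_word => /andP[/eqP].
case: (drop_runP s i (u_word (iota s.+1 q))) => [->|[r' ->//]|[i' -> ->]];
case: (drop_runP s j (u_word (iota s.+1 q))) => [->|[r' ->//]|[j' -> ->]] //.
- by rewrite drop0 => /H0-> /mark_ge; rewrite ltnn.
- by rewrite drop0 => + /H0 => + Es; rewrite Es => /mark_ge; rewrite ltnn.
by move=> Hi Hj; rewrite (IHq s.+1 i' j').
Qed.

Lemma mark_exists e s q : s <= e -> e.+1 < s + q ->
  exists i, prefix (mark e) (drop i (u_word (iota s q))).
Proof.
elim: q s => [|q IHq] s; first by lia.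
rewrite leq_eqVlt => /predU1P[->|se] eq; last first.
  have [||i Hi] := IHq s.+1; [by []|lia|].
  exists (s.+1 + i)%N; rewrite [iota _ _]/= u_word_cons -cat_cons drop_cat /= size_nseq.
  by rewrite ltnNge leq_addr /= addKn.
case: q eq {IHq} => [|q] eq; first lia.
exists 0; rewrite drop0 [iota _ _]/= u_word_cons prefix_mark_u_word eqxx.
by rewrite u_tail_cons prefix_nseq_La eqxx prefix0s.
Qed.

Lemma rev_mark e : rev (mark e) = La :: nseq e.+1 Lb ++ La :: nseq e Lb ++ [:: La].
Proof.
rewrite /mark -cat1s rev_cat rev_cat rev_cons rev_cat !rev_nseq.
by rewrite -!cats1 -!catA.
Qed.

(** The reversed mark has a run followed by a shorter one, whereas the runs of this word
    increase. *)
Lemma rev_mark_u_word e s q i :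
  ~~ prefix (rev (mark e)) (drop i (u_word (iota s q))).
Proof.
rewrite rev_mark; elim: q s i => [|q IHq] s i.
  apply/negP => /size_prefix; rewrite size_drop /= !(size_cat, size_nseq) /=.
  by rewrite size_cat size_nseq /=; lia.
rewrite [iota _ _]/= u_word_cons.
case: (drop_runP s i (u_word (iota s.+1 q))) => [->|[r' ->]|[j _ ->]] //.
rewrite drop0 prefix_cons eqxx prefix_nseq_La andTb.
case: q {IHq} => [|q]; first by case: e => [|e]; rewrite ?andbF.
apply/negP => /andP[/eqP <-]; rewrite -/(u_tail _) [iota _ _]/= u_tail_cons.
by rewrite prefix_nseq_La => /andP[/eqP]; lia.
Qed.

(** Serves to exclude reversed marks whose letters [La] and [Lb] have been exchanged: these contain
    two consecutive [La] when the exponent is positive. *)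
Lemma LaLa_u_word s q i : 0 < s ->
  ~~ prefix [:: La; La] (drop i (u_word (iota s q))).
Proof.
elim: q s i => [|q IHq] s i s_gt0; first by case: i => [|[]].
rewrite [iota _ _]/= u_word_cons.
case: (drop_runP s i (u_word (iota s.+1 q))) => [->|[r' ->]|[j _ ->]] //; last exact: IHq.
by case: s s_gt0.
Qed.

(* Marks straddling the boundary [n0] of [w]: the boundary lies in the first
   or in the second run of [Lb]'s of such a mark, and [t] is the length of
   that run. *)
Lemma mark_straddle w n0 e i : i < n0 -> n0 < i + size (mark e) ->
  prefix (mark e) (drop i w) ->
  let t := (run (rev (take n0 w)) + run (drop n0 w))%N in e = t \/ e = t.-1.
Proof.
rewrite size_mark => i_lt lt_n0 /prefixP[r Er] t.
have i_le : i <= size w by apply/ltnW/(@prefix_size_drop _ (mark e)) => //; apply/prefixP; exists r.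
set d := (n0 - i)%N.
have Et : take n0 w = take i w ++ take d (mark e ++ r).
  by rewrite -{1}(cat_take_drop i w) take_cat size_take_min (minn_idPl i_le) Er ltnNge (ltnW i_lt).
have Ed : drop n0 w = drop d (mark e ++ r).
  by rewrite -Er drop_drop /d subnK // ltnW.
have run_rev x n y : run (rev (x ++ La :: nseq n Lb) ++ y) = n.
  by rewrite rev_cat rev_cons rev_nseq -cats1 -!catA run_nseq.
rewrite /t Et Ed /mark.
(* [d] letters of the mark precede the boundary. Up to [e+1], the cut splits the first run into
   [d-1] and [e-(d-1)] letters, so [t = e]; beyond, it splits the second run and [t = e+1]. *)
case: (leqP d e.+1) => de.
  left; have -> : take d ((La :: nseq e Lb ++ La :: nseq e.+1 Lb ++ [:: La]) ++ r)
     = La :: nseq d.-1 Lb.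
    have -> : d = d.-1.+1 by lia.
    rewrite /= -catA take_cat size_nseq; case: ltnP => dd.
      by rewrite take_nseq //; lia.
    have -> : d.-1 = e by lia.
    by rewrite subnn take0 cats0.
  have -> : drop d ((La :: nseq e Lb ++ La :: nseq e.+1 Lb ++ [:: La]) ++ r)
     = nseq (e - d.-1) Lb ++ La :: (nseq e.+1 Lb ++ [:: La]) ++ r.
    have -> : d = d.-1.+1 by lia.
    rewrite /= -catA drop_cat size_nseq; case: ltnP => dd.
      by rewrite drop_nseq.
    have -> : d.-1 = e by lia.
    by rewrite subnn drop0.
  by rewrite -[rev _]cats0 run_rev run_nseq; lia.
right; set m := (d - e.+2)%N.
have Ed' : d = (e.+2 + m)%N by lia.
have dm : m <= e.+1 by lia.
pose x := La :: nseq e Lb.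
have sx : size (rcons x La) = e.+2 by rewrite size_rcons /= size_nseq.
have -> : (La :: nseq e Lb ++ La :: nseq e.+1 Lb ++ [:: La]) ++ r
   = rcons x La ++ (nseq m Lb ++ (nseq (e.+1 - m) Lb ++ La :: r)).
  rewrite [nseq m Lb ++ _]catA -nseqD subnKC // -cats1 /x /= -!catA /=.
  by rewrite -catA.
rewrite Ed' take_cat drop_cat sx ltnNge leq_addr /= addKn.
rewrite take_size_cat ?size_nseq // drop_size_cat ?size_nseq // run_nseq.
rewrite -cats1 -catA cat1s -[rev _]cats0.
by rewrite -[La :: nseq e Lb ++ _]cat_cons catA run_rev; lia.
Qed.

(** * Windows *)

Section Windows.
Variables (V : Type) (orb : V -> bool).

(** If [l] starts at an orbit point, this is the o-geodesic of o-length [k] starting there: the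
    shortest prefix with [k+1] orbit points. Recursion on vertices, instead of lists of positions,
    suits concatenation and reversal. *)
Fixpoint win (k : nat) (l : seq V) : option (seq V) :=
  if l is x :: l' then
    if orb x then
      if k is k'.+1 then omap (cons x) (win k' l') else Some [:: x]
    else omap (cons x) (win k l')
  else None.

Fixpoint wins (k : nat) (l : seq V) : seq (seq V) :=
  if l is x :: l' then
    if orb x then if win k l is Some w then w :: wins k l' else [::]
    else wins k l'
  else [::].

Lemma win_isSome k l : win k l = (k < count orb l) :> bool.
Proof.
elim: l k => [|x l IHl] k //=; have isS k' : isSome (omap (cons x) (win k' l)) = (k' < count orb l).
  by rewrite -IHl; case: win.
by case: ifP => _; rewrite ?add0n //; case: k => [|k] //; rewrite isS.
Qed.

Lemma win_None k l : count orb l <= k -> win k l = None.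
Proof. by rewrite leqNgt -win_isSome; case: win. Qed.

Lemma win_Some k l : k < count orb l -> exists w, win k l = Some w.
Proof. by rewrite -win_isSome; case: win => // w; exists w. Qed.

Lemma win_cat k l l' : k < count orb l -> win k (l ++ l') = win k l.
Proof.
elim: l k => [|x l IHl] k //=; case: ifP => _; last by rewrite add0n => /IHl->.
by case: k => [|k] //; rewrite add1n ltnS => /IHl->.
Qed.

Lemma win_full k l x : orb x -> count orb l = k -> win k (rcons l x) = Some (rcons l x).
Proof.
move=> orbx; elim: l k => [|y l IHl] k /=; first by rewrite orbx => <-.
by case: ifP => _; [case: k => [|k] //; case=> /IHl-> | move=> /IHl->].
Qed.

Lemma wins_consE k x l : wins k (x :: l) =
  if orb x then if win k (x :: l) is Some w then w :: wins k l else [::]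
  else wins k l.
Proof. by []. Qed.

Lemma wins_nil k l : count orb l <= k -> wins k l = [::].
Proof.
elim: l => // x l IHl le_k; rewrite wins_consE win_None //.
by move: le_k => /=; case: (orb x) => // /IHl.
Qed.

Lemma wins_cons k x l : orb x -> k <= count orb l ->
  exists2 w, win k (x :: l) = Some w & wins k (x :: l) = w :: wins k l.
Proof.
move=> orbx le_k; have [|w Ew] := @win_Some k (x :: l); first by rewrite /= orbx.
by exists w => //; rewrite wins_consE orbx Ew.
Qed.

Lemma wins_skip k x l : ~~ orb x -> wins k (x :: l) = wins k l.
Proof. by move=> /negPf/= ->. Qed.

Lemma size_wins k l : size (wins k l) = count orb l - k.
Proof.
elim: l => // x l IHl; have [orbx|norbx] := boolP (orb x); last first.
  by rewrite wins_skip // IHl /= (negPf norbx).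
have [le_k|lt_k] := leqP k (count orb l).
  by have [w _ ->] := wins_cons orbx le_k; rewrite /= IHl orbx; lia.
by rewrite wins_nil /= orbx; lia.
Qed.

Lemma wins_cat k l l' : exists r, wins k (l ++ l') = wins k l ++ r.
Proof.
elim: l => [|x l [r IHl]]; first by exists (wins k l').
have [orbx|norbx] := boolP (orb x); last by exists r; rewrite cat_cons !wins_skip.
have [le_k|lt_k] := leqP k (count orb l); last first.
  by exists (wins k ((x :: l) ++ l')); rewrite [in RHS]wins_nil //= orbx; lia.
have [w Ew ->] := wins_cons orbx le_k.
exists r; rewrite cat_cons wins_consE orbx -cat_cons win_cat ?Ew ?IHl //=.
by rewrite orbx; lia.
Qed.

(** Each orbit point of [l] starts at most one window, and if one of them starts none, then neither
    does any point of [l']. *)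
Lemma wins_drop k l l' : drop (count orb l) (wins k (l ++ l')) = wins k l'.
Proof.
elim: l => [|x l IHl]; first by rewrite drop0.
have [orbx|norbx] := boolP (orb x); last by rewrite cat_cons wins_skip //= (negPf norbx).
rewrite cat_cons [count _ _]/= orbx.
have [le_k|lt_k] := leqP k (count orb (l ++ l')).
  by have [w _ ->] := wins_cons orbx le_k.
rewrite !wins_nil //=; last by rewrite orbx; lia.
by move: lt_k; rewrite count_cat; lia.
Qed.

(** The only possible new window ends at [x] and is found by reading the path backwards. This is the
    inductive step of [wins_rev]. *)
Lemma wins_rcons k l x : wins k (rcons l x) =
  wins k l ++ (if orb x then if win k (x :: rev l) is Some w then [:: rev w] else [::] else [::]).
Proof.
elim: l => [|y l IHl]; first by rewrite /=; case: (orb x) => //; case: k.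
have Cr : count orb (rev l) = count orb l by rewrite count_rev.
rewrite rcons_cons rev_cons -[rcons (rev l) y]cats1 -cat_cons.
have [orby|norby] := boolP (orb y); last first.
  rewrite !wins_skip // IHl; case: ifP => // orbx.
  have [ck|ck] := ltnP k (count orb (x :: rev l)); first by rewrite win_cat.
  by rewrite !win_None //; move: ck; rewrite count_cat /= (negPf norby); lia.
rewrite wins_consE orby.
have [le_k|lt_k] := leqP k (count orb l).
  have [w Ew ->] := wins_cons orby le_k.
  rewrite -cats1 -cat_cons win_cat ?Ew ?[l ++ _]cats1 ?IHl; last by rewrite /= orby.
  case: ifP => // orbx; rewrite win_cat //=; last by rewrite orbx Cr; lia.
rewrite [wins k (y :: l)]wins_nil ?cat0s; last by rewrite /= orby.
case: (boolP (orb x)) => [orbx|norbx]; last first.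
  by rewrite win_None //= orby -cats1 count_cat /= (negPf norbx); lia.
(* With exactly [k+1] orbit points in all, the whole list is the single window, found from either
   end. *)
have [ck|ck] := eqVneq (count orb l).+1 k; last first.
  rewrite !win_None //=; first by rewrite orbx count_cat /= orby Cr; lia.
  by rewrite orby -cats1 count_cat /= orbx; lia.
rewrite -rcons_cons win_full //; last by rewrite /= orby.
rewrite cats1 win_full //; last by rewrite /= orbx Cr.
rewrite wins_nil; last by rewrite -cats1 count_cat /= orbx; lia.
by rewrite rev_rcons rev_cons revK.
Qed.

Lemma wins_rev k l : wins k (rev l) = rev (map rev (wins k l)).
Proof.
elim: l => // x l IHl; rewrite rev_cons wins_rcons IHl wins_consE revK.
case: (boolP (orb x)) => orbx; last by rewrite cats0.
have [le_k|lt_k] := leqP k (count orb l).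
  by have [|w ->] := @win_Some k (x :: l); rewrite /= ?orbx // rev_cons cats1.
by rewrite win_None /= ?orbx // wins_nil //; exact: ltnW.
Qed.

End Windows.

(** * Marks along a path *)

Section Marks.
Variables (V : Type) (orb : V -> bool) (k : nat) (f : seq V -> lab).

Definition wd (l : seq V) : seq lab := map f (wins orb k l).

(** The test on [x] prevents a mark from being counted again at vertices off the orbit, where [wd]
    has the same value as at the next orbit point. *)
Definition occ (e : nat) (l : seq V) : bool :=
  if l is x :: _ then orb x && prefix (mark e) (wd l) else false.

Lemma wd_cat l l' : prefix (wd l) (wd (l ++ l')).
Proof. by have [r E] := wins_cat orb k l l'; rewrite /wd E map_cat prefix_prefix. Qed.

Lemma wd_drop l l' : wd l' = drop (count orb l) (wd (l ++ l')).
Proof. by rewrite /wd -map_drop wins_drop. Qed.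

Lemma size_wd l : size (wd l) = count orb l - k.
Proof. by rewrite size_map size_wins. Qed.

Lemma occ_small e l : size l < e -> occ e l = false.
Proof.
case: l => // x l le; apply/negP => /andP[_ /size_prefix].
rewrite size_mark size_wd; have := count_size orb (x :: l); lia.
Qed.

Lemma occ_catl e x l l' : occ e (x :: l) -> occ e (x :: l ++ l').
Proof. by move=> /andP[orbx /prefix_trans pr]; rewrite /= orbx -cat_cons pr ?wd_cat. Qed.

(** Going on past [c] along [Q] completes no mark of exponent [e] that starts in [P]. *)
Definition unbroken e P c Q := forall P1 x P2, P = P1 ++ x :: P2 ->
  occ e (x :: P2 ++ c :: Q) = occ e (x :: P2 ++ [:: c]).

(** A broken mark whose first window lies in [P ++ [:: c]] straddles the end [n0] of such windows,
    which leaves the two exponents of [mark_straddle]. Otherwise it starts at one of the [k]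
    positions from [n0] on, and each position determines the exponent as the run after its first
    letter. *)
Lemma broken_marks P c Q : exists2 Bad, size Bad = k.+2 &
  forall e, e \notin Bad -> unbroken e P c Q.
Proof.
set W := wd (P ++ c :: Q); set n0 := count orb (P ++ [:: c]) - k.
set t := (run (rev (take n0 W)) + run (drop n0 W))%N.
exists (t :: t.-1 :: [seq run (drop i.+1 W) | i <- iota n0 k]).
  by rewrite /= size_map size_iota.
move=> e; rewrite !inE !negb_or => /and3P[et et1 e_run] P1 x P2 EP.
apply/idP/idP; last by rewrite -[c :: Q]cat1s catA; exact: occ_catl.
case/andP => orbx; rewrite /= orbx; set i := count orb P1.
have Ewd l : wd (x :: P2 ++ l) = drop i (wd (P ++ l)).
  by rewrite EP -catA; exact: wd_drop.
have EW : wd (P ++ [:: c]) = take n0 W.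
  rewrite /n0 -(size_wd (P ++ [:: c])); have := wd_cat (P ++ [:: c]) Q.
  by rewrite -catA prefixE => /eqP.
rewrite !Ewd EW -/W => mi.
have i_lt : i < n0.
  rewrite ltnNge; apply/negP => n0_le; move/negP: e_run; apply.
  have Ei : e = run (drop i.+1 W).
    rewrite -add1n -drop_drop; case/prefixP: mi => r ->.
    by rewrite /mark cat_cons drop1 [behead _]/= -catA cat_cons run_nseq.
  rewrite Ei; apply: (map_f (fun i => run (drop i.+1 W))).
  rewrite mem_iota n0_le /n0 EP !count_cat /= orbx -/i; lia.
have le_n0 : i + size (mark e) <= n0.
  rewrite leqNgt; apply/negP => lt_n0.
  by case: (mark_straddle i_lt lt_n0 mi) => /eqP; apply/negP.
rewrite -(subnK (ltnW i_lt)) -take_drop; case/prefixP: mi => r ->.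
apply/prefixP; exists (take (n0 - i - size (mark e)) r).
by rewrite take_cat ltnNge (_ : size _ <= _) //; lia.
Qed.

Lemma count_split i l : i < count orb l ->
  exists l1 x l2, [/\ l = l1 ++ x :: l2, orb x & count orb l1 = i].
Proof.
elim: l i => //= y l IHl i; case: (boolP (orb y)) => orby lt_i; last first.
  have [l1 [x [l2 [-> orbx Ei]]]] := IHl _ lt_i.
  by exists (y :: l1), x, l2; split; rewrite //= (negPf orby).
case: i lt_i => [|i] lt_i; first by exists [::], y, l.
have [l1 [x [l2 [-> orbx Ei]]]] := IHl _ lt_i.
by exists (y :: l1), x, l2; split; rewrite //= orby Ei.
Qed.

Lemma occ_drop e l1 x l2 : occ e (x :: l2) =
  orb x && prefix (mark e) (drop (count orb l1) (wd (l1 ++ x :: l2))).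
Proof. by rewrite -wd_drop. Qed.

End Marks.

(** * Signed products along a path *)

Section Theta.
Variables (V : Type) (H : gops) (gH : is_group H).
Local Notation "x * y" := (gmul x y).
Local Notation "x ^-1" := (ginv x).
Implicit Types (F : seq V -> H) (l past fut : seq V).

(* [past] is read backwards from the current vertex, so that each factor is
   inverted when the path is reversed. *)
Fixpoint theta F past l fut : H :=
  if l is x :: l' then
    (F (x :: past))^-1 * F (x :: l' ++ fut) * theta F (x :: past) l' fut
  else gone H.

Definition Theta F l := theta F [::] l [::].

Lemma theta_cons F past x l fut : theta F past (x :: l) fut =
  (F (x :: past))^-1 * F (x :: l ++ fut) * theta F (x :: past) l fut.
Proof. by []. Qed.

Lemma theta_cat F past l1 l2 fut : theta F past (l1 ++ l2) fut =
  theta F past l1 (l2 ++ fut) * theta F (rev l1 ++ past) l2 fut.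
Proof.
elim: l1 past => [|x l1 IHl] past /=; first by rewrite (gmul1 gH).
by rewrite IHl -catA rev_cons cat_rcons !(gmulA gH).
Qed.

Lemma theta_rev F past l fut : theta F fut (rev l) past = (theta F past l fut)^-1.
Proof.
elim: l past => [|x l IHl] past /=; first by rewrite (ginv1 gH).
rewrite rev_cons -cats1 theta_cat /= IHl revK !(ginvM gH) (ginvK gH).
by rewrite (gmul1r gH) !(gmulA gH).
Qed.

Lemma Theta_rev F l : Theta F (rev l) = (Theta F l)^-1.
Proof. exact: theta_rev. Qed.

Lemma theta_ext F F' past past' l fut fut' :
  (forall l1 x l2, l = l1 ++ x :: l2 ->
     F (x :: l2 ++ fut) = F' (x :: l2 ++ fut') /\
     F (x :: rev l1 ++ past) = F' (x :: rev l1 ++ past')) ->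
  theta F past l fut = theta F' past' l fut'.
Proof.
elim: l past past' => //= x l IHl past past' EF.
have [] := EF [::] x l erefl; rewrite /= => -> ->; congr (_ * _).
apply: IHl => l1 y l2 El; have [] := EF (x :: l1) y l2; first by rewrite El.
by rewrite rev_cons !cat_rcons.
Qed.

(** The contribution of the branch [Q] at [c]. It does not see the other branches, so it can cancel
    between two sides of a tripod. *)
Definition half_theta F c Q := F (c :: Q) * theta F [:: c] Q [::].

(* The factor of [Theta] at [c] is shared between the two halves, one of which
   is read backwards. *)
Lemma Theta_split F P c Q :
  (forall P1 x P2, P = P1 ++ x :: P2 -> F (x :: P2 ++ c :: Q) = F (x :: P2 ++ [:: c])) ->
  (forall Q1 x Q2, rev Q = Q1 ++ x :: Q2 -> F (x :: Q2 ++ c :: rev P) = F (x :: Q2 ++ [:: c])) ->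
  Theta F (P ++ c :: Q) = (half_theta F c (rev P))^-1 * half_theta F c Q.
Proof.
move=> FP FQ; rewrite /Theta theta_cat /= !cats0 /half_theta (ginvM gH).
rewrite -(theta_rev F [:: c]) revK -!(gmulA gH); congr (_ * (_ * (_ * _))).
  by apply: theta_ext => l1 x l2 EP; split=> //; exact: FP EP.
apply: theta_ext => l1 x l2 EQ; split=> //; apply: (FQ (rev l2)).
by rewrite EQ rev_cat rev_cons cat_rcons.
Qed.

Lemma Theta1 F x : Theta F [:: x] = gone H.
Proof. by rewrite /Theta /= (gmulV gH) (gmul1 gH). Qed.

End Theta.

(** * Transfer of positive sentences *)

Section Equivariance.
Variables (V : Type) (orb : V -> bool) (k : nat) (f : seq V -> lab) (a : V -> V).
Hypotheses (orb_a : forall x, orb (a x) = orb x).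
Hypotheses (f_a : forall J, f (map a J) = f J).

Lemma win_map k' l : win orb k' (map a l) = omap (map a) (win orb k' l).
Proof.
elim: l k' => //= x l IHl k'; rewrite orb_a IHl; case: ifP => _; last by case: win.
by case: k' => //= k'; rewrite IHl; case: win.
Qed.

Lemma wd_map l : wd orb k f (map a l) = wd orb k f l.
Proof.
rewrite /wd; elim: l => // x l IHl; rewrite map_cons !wins_consE -map_cons win_map orb_a.
case: ifP => // _; case: win => //= w.
by rewrite f_a IHl.
Qed.

End Equivariance.

(* [path g] plays the role of the geodesic from the base point [v] to [g v]. *)
Record path_system (G : gops) (V : Type) (act : G -> V -> V)
    (orb : V -> bool) (k : nat) (f : seq V -> lab) (path : G -> seq V) : Prop := {
  ps_orb : forall g x, orb (act g x) = orb x;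
  ps_lab : forall g J, f (map (act g) J) = f J;
  ps_one : exists v, path (gone G) = [:: v];
  ps_tripod : forall g h, exists P c Q R,
    [/\ path g = P ++ c :: Q, map (act g) (path h) = rev Q ++ c :: R
      & path (gmul g h) = P ++ c :: R];
  ps_rich : forall s q, 0 < s -> exists g,
    wd orb k f (path g) = u_word (iota s q) /\
    forall e i, 0 < e -> ~~ prefix (mark e) (drop i (wd orb k f (rev (path g)))) }.

Section Transfer.
Variables (G : gops) (V : Type) (act : G -> V -> V).
Variables (orb : V -> bool) (k : nat) (f : seq V -> lab) (path : G -> seq V).
Hypotheses (gG : is_group G) (ps : path_system act orb k f path).
Variables (H : gops) (gH : is_group H).

Local Notation occ := (occ orb k f).
Local Notation unbroken := (unbroken orb k f).

Implicit Types (s : seq (nat * H)) (l : seq V).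

(** At most one exponent has its mark at the head of [l]; an exponent repeated in [s] takes its
    first value. *)
Fixpoint pick_occ s l : H :=
  if s is (e, h) :: s' then if occ e l then h else pick_occ s' l else gone H.

Lemma pick_occ_cons e h s l :
  pick_occ ((e, h) :: s) l = if occ e l then h else pick_occ s l.
Proof. by []. Qed.

Definition shadow s g := Theta (pick_occ s) (path g).

Definition avoids s (Bad : seq nat) := forall e, e \in map fst s -> e \notin Bad.

Lemma avoids_cat s Bad1 Bad2 :
  avoids s (Bad1 ++ Bad2) -> avoids s Bad1 /\ avoids s Bad2.
Proof.
by move=> av; split=> e /av; rewrite mem_cat negb_or => /andP[].
Qed.

Lemma pick_occ_act s g l : pick_occ s (map (act g) l) = pick_occ s l.
Proof.
have occ_act e : occ e (map (act g) l) = occ e l.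
  by case: l => // x l; rewrite -[RHS]/(_ && _) -(ps_orb ps g)
    -(wd_map k (ps_orb ps g) (ps_lab ps g)).
by elim: s => //= -[e h] s ->; rewrite occ_act.
Qed.

Lemma Theta_act s g l : Theta (pick_occ s) (map (act g) l) = Theta (pick_occ s) l.
Proof.
suff Et past fut : theta (pick_occ s) (map (act g) past) (map (act g) l) (map (act g) fut)
    = theta (pick_occ s) past l fut by exact: (Et [::] [::]).
elim: l past => //= x l IHl past.
by rewrite -map_cat -!map_cons IHl !pick_occ_act.
Qed.

Lemma pick_occ_unbroken s P c Q : (forall e, e \in map fst s -> unbroken e P c Q) ->
  forall P1 x P2, P = P1 ++ x :: P2 ->
  pick_occ s (x :: P2 ++ c :: Q) = pick_occ s (x :: P2 ++ [:: c]).
Proof.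
elim: s => // -[e h] s IHs un P1 x P2 EP.
rewrite !pick_occ_cons (un e _ P1 x P2 EP) ?inE ?eqxx // (IHs _ P1 x P2 EP) //.
by move=> e' se'; apply: un; rewrite inE se' orbT.
Qed.

(** Marks can be broken at [c] in both directions, hence twice the constant of [broken_marks]. [Bad]
    is fixed before any values in [H] are. *)
Lemma Theta_junction P c Q : exists2 Bad, size Bad = (2 * k.+2)%N &
  forall s, avoids s Bad -> Theta (pick_occ s) (P ++ c :: Q) =
    gmul (ginv (half_theta (pick_occ s) c (rev P))) (half_theta (pick_occ s) c Q).
Proof.
have [B1 sB1 un1] := broken_marks orb k f P c Q.
have [B2 sB2 un2] := broken_marks orb k f (rev Q) c (rev P).
exists (B1 ++ B2); first by rewrite size_cat sB1 sB2 mul2n addnn.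
move=> s /avoids_cat[av1 av2]; apply: Theta_split => //.
  by apply: pick_occ_unbroken => e /av1/un1.
by apply: pick_occ_unbroken => e /av2/un2.
Qed.

(** With [A], [B], [C] the half products of the three branches at the centre, the identity reads
    [A^-1 C = (A^-1 B)(B^-1 C)]. The constant counts three junctions. *)
Lemma shadowM g h : exists2 Bad, size Bad = (6 * k.+2)%N &
  forall s, avoids s Bad -> shadow s (gmul g h) = gmul (shadow s g) (shadow s h).
Proof.
have [P [c [Q [R [Eg Eh Egh]]]]] := ps_tripod ps g h.
have [B1 sB1 E1] := Theta_junction P c Q.
have [B2 sB2 E2] := Theta_junction (rev Q) c R.
have [B3 sB3 E3] := Theta_junction P c R.
exists (B1 ++ B2 ++ B3); first by rewrite !size_cat sB1 sB2 sB3; lia.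
move=> s /avoids_cat[/E1 {}E1 /avoids_cat[/E2 {}E2 /E3 {}E3]].
rewrite /shadow -(Theta_act s g (path h)) Eg Eh Egh E1 E2 E3 revK.
by rewrite -(gmulA gH) (gmulK gH).
Qed.

Lemma shadow1 s : shadow s (gone G) = gone H.
Proof. by have [v Ev] := ps_one ps; rewrite /shadow Ev Theta1. Qed.

(** Inversion spoils no exponent: the tripod of [g] and its inverse has only the branch [Q], so the
    translated path of the inverse is exactly the reversed path of [g]. *)
Lemma shadowV s g : shadow s (ginv g) = ginv (shadow s g).
Proof.
have [P [c [Q [R [Eg Eh Egh]]]]] := ps_tripod ps g (ginv g).
have [v Ev] := ps_one ps; move: Egh; rewrite (gmulVr gG) Ev.
case: P Eg => [|p [|p' P]] //= Eg [Ec]; case: R Eh => //= Eh _.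
rewrite /shadow -(Theta_act s g (path _)) Eh Eg -(Theta_rev gH) rev_cons.
by rewrite cats1.
Qed.

Lemma shadow_eval_word (w : gword) (env : nat -> G) :
  exists2 Bad, size Bad = (size w * (6 * k.+2))%N &
  forall s, avoids s Bad ->
    shadow s (eval_word env w) = eval_word (fun y => shadow s (env y)) w.
Proof.
elim: w => [|[x b] w [Bad sBad IHw]].
  by exists [::] => // s _; exact: shadow1.
have [Bad' sBad' EM] := shadowM (if b then ginv (env x) else env x) (eval_word env w).
exists (Bad' ++ Bad); first by rewrite size_cat sBad sBad' mulSn.
move=> s /avoids_cat[/EM {}EM /IHw {}IHw].
by rewrite [eval_word _ _ in LHS]/= EM IHw /=; case: b {EM} => //; rewrite shadowV.
Qed.

(** A mark whose exponent exceeds the size of the path does not fit in it, so values attached later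
    leave the elements already chosen undisturbed. *)
Lemma shadow_small s e h g : size (path g) < e -> shadow ((e, h) :: s) g = shadow s g.
Proof.
move=> le; apply: theta_ext => l1 x l2 El.
by split; rewrite pick_occ_cons occ_small //; move: le;
   rewrite El !cats0 /= ?size_rev size_cat /=; lia.
Qed.

(** Each of these marks occurs once along the path and never along its reversal, so [h] enters
    exactly one factor. One [g] serves all [q] exponents, because it must be played before the
    spoiled ones are known. *)
Lemma shadow_generic n q : exists g,
  forall e, n < e <= n + q -> forall s, exists u v, forall h,
    shadow ((e, h) :: s) g = gmul u (gmul h v).
Proof.
(* The mark of exponent [n+q] also uses a run of length [n+q+1], hence [q+1] runs. *)
have [|g [Eg Erev]] := ps_rich ps (s := n.+1) q.+1; first by [].
exists g => e /andP[lt_ne le_e] s.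
have [|i mi] := @mark_exists e n.+1 q.+1 lt_ne; first by lia.
have i_lt : i < count orb (path g).
  have := prefix_size_drop _ mi; rewrite -Eg size_wd => /(_ isT) lti.
  by apply: leq_trans lti _; apply: leq_subr.
have [l1 [x [l2 [El orbx Ei]]]] := count_split i_lt.
pose p := pick_occ s.
exists (gmul (theta p [::] l1 (x :: l2)) (ginv (p (x :: rev l1)))),
  (theta p (x :: rev l1) l2 [::]) => h.
(* Forwards, the mark is seen only at the orbit point of index [i]; backwards, by [occR],
   nowhere. *)
have occE k1 y k2 : path g = k1 ++ y :: k2 -> occ e (y :: k2) = orb y && (count orb k1 == i).
  move=> Ek; rewrite (occ_drop _ _ _ _ k1) -Ek Eg; congr (_ && _).
  by apply/idP/eqP => [mj|->//]; exact: mark_uniq mj mi.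
have occR k1 y k2 : path g = k1 ++ y :: k2 -> occ e (y :: rev k1) = false.
  move=> Ek; rewrite (occ_drop _ _ _ _ (rev k2)) -cat_rcons -rev_cons -rev_cat -Ek.
  by rewrite (negPf (Erev _ _ _)) ?andbF //; lia.
have cl1 j y l1' : l1 = j ++ y :: l1' -> orb y -> (count orb j == i) = false.
  by move=> El1 orby; apply/eqP; rewrite -Ei El1 count_cat /= orby; lia.
rewrite /shadow /Theta El (theta_cat gH) theta_cons !cats0.
rewrite !pick_occ_cons (occE l1 x l2) // orbx Ei eqxx (occR l1 x l2) //.
rewrite -!(gmulA gH); congr (gmul _ (gmul _ (gmul _ _))).
  apply: theta_ext => j y l1' El1; rewrite !pick_occ_cons cats0.
  have Ej : path g = j ++ y :: l1' ++ x :: l2 by rewrite El El1 -catA.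
  rewrite (occE _ _ _ Ej) (occR _ _ _ Ej); split=> //.
  by case: (boolP (orb y)) => //= orby; rewrite (cl1 _ _ _ El1).
apply: theta_ext => j y l2' El2; rewrite !pick_occ_cons cats0.
have Ej : path g = (l1 ++ x :: j) ++ y :: l2' by rewrite El El2 -catA.
have := occR _ _ _ Ej; rewrite rev_cat rev_cons cat_rcons => ->.
rewrite (occE _ _ _ Ej) count_cat /= orbx Ei; split=> //.
by rewrite (_ : (_ == i) = false) ?andbF //; apply/eqP; lia.
Qed.

(** Bounds the exponents spoiled by a formula uniformly in the environment, so that it is known
    before [g] is played. *)
Fixpoint cost (p : pform) : nat :=
  match p with
  | PEq w => size w * (6 * k.+2)
  | PAnd p1 p2 | POr p1 p2 => cost p1 + cost p2
  | PAll _ p | PEx _ p => cost p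
  end.

Lemma shadow_upd s (env : nat -> G) x g :
  (fun y => shadow s (upd env x g y)) =
  upd (fun y => shadow s (env y)) x (shadow s g).
Proof. by apply/funext => y; rewrite /upd; case: ifP. Qed.

(** The bound on path sizes in the environment leaves all larger exponents free for the next
    universal quantifier. *)
Lemma holds_shadow (p : pform) (env : nat -> G) :
  (exists n, forall y, size (path (env y)) <= n) -> holds_env env p ->
  exists2 Bad, size Bad <= cost p &
  forall s, avoids s Bad -> holds_env (fun y => shadow s (env y)) p.
Proof.
have bound_upd (env' : nat -> G) x g :
    (exists n, forall y, size (path (env' y)) <= n) ->
    exists n, forall y, size (path (upd env' x g y)) <= n.
  case=> n le_n; exists (maxn n (size (path g))) => y; rewrite /upd leq_max.
  by case: ifP; rewrite ?le_n ?leqnn ?orbT.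
elim: p env => [w|p IHp q IHq|p IHp q IHq|x p IHp|x p IHp] env bd /=.
- move=> Ew; have [Bad sBad EB] := shadow_eval_word w env.
  by exists Bad; rewrite ?sBad // => s /EB <-; rewrite Ew shadow1.
- case=> /(IHp _ bd)[B1 s1 H1] /(IHq _ bd)[B2 s2 H2].
  exists (B1 ++ B2); first by rewrite size_cat leq_add.
  by move=> s /avoids_cat[/H1 ? /H2].
- case=> [/(IHp _ bd)[B s1 H1]|/(IHq _ bd)[B s1 H1]]; exists B; try lia.
    by move=> s /H1; left.
  by move=> s /H1; right.
(* One exponent more than the formula can spoil, all beyond the current sizes: by pigeonhole one
   survives, and [h'] below solves [u h' v = h] for it. *)
- have [n le_n] := bd; have [g Eg] := shadow_generic n (cost p).+1.
  move=> /(_ g) /(IHp _ (bound_upd _ x g bd))[Bad sBad HB]; exists Bad => // s av h.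
  have /allPn[e] : ~~ all (mem Bad) (iota n.+1 (cost p).+1).
    apply/negP => /allP sub; have := uniq_leq_size (iota_uniq _ _) sub.
    by rewrite size_iota ltnNge sBad.
  rewrite mem_iota addSnnS => /andP[lt_ne le_e] eBad.
  have [|u [v Euv]] := Eg e _ s; first by rewrite lt_ne; lia.
  pose h' := gmul (ginv u) (gmul h (ginv v)).
  have /HB : avoids ((e, h') :: s) Bad.
    by move=> e'; rewrite inE => /predU1P[->|/av].
  rewrite shadow_upd Euv -!(gmulA gH) (gmulV gH) (gmul1r gH) (gmulK gH).
  (* The other variables keep their values, since [e] exceeds the sizes of their paths. *)
  rewrite (_ : upd _ _ _ = upd (fun y => shadow s (env y)) x h) //.
  apply/funext => y; rewrite /upd; case: ifP => // _.
  by rewrite shadow_small //; apply: leq_ltn_trans (le_n y) _.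
(* The shadow of the witness in [G] is a witness in [H]. *)
- case=> g /(IHp _ (bound_upd _ x g bd))[Bad sBad HB]; exists Bad => // s /HB Hs.
  by exists (shadow s g); rewrite -shadow_upd.
Qed.

(** The assignment is empty at the start; only universal quantifiers enlarge it. *)
Lemma holds_transfer (p : pform) : holds G p -> holds H p.
Proof.
case/holds_shadow => [|Bad _ HB].
  by exists (size (path (gone G))) => _.
have /HB : avoids [::] Bad by [].
by rewrite (_ : (fun _ => _) = fun=> gone H) //; apply/funext => y; rewrite shadow1.
Qed.

End Transfer.

(** * The free group *)

Section FreeGroup.
Implicit Types (l : letter) (u v w : seq letter).

Lemma linvK : involutive linv.
Proof. by case=> a b; rewrite /linv /= negbK. Qed.

Definition winv w := rev (map linv w).

Lemma winv_cat u v : winv (u ++ v) = winv v ++ winv u.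
Proof. by rewrite /winv map_cat rev_cat. Qed.

Lemma pushK l w : reduced w -> push l (push (linv l) w) = w.
Proof.
case: w => [|l' w] /=; first by rewrite eqxx.
rewrite linvK; case: eqP => [->|_ _] /=; last by rewrite eqxx.
by case: w => [|y w] //= /andP[/negPf->].
Qed.

Lemma reduce_id w : reduced w -> reduce w = w.
Proof.
elim: w => //= l w IHw red; rewrite IHw; last exact: path_sorted red.
by case: w red {IHw} => //= y w /andP[/negPf->].
Qed.

Lemma reduced_foldr_push w u : reduced w -> reduced (foldr push w u).
Proof. by move=> red; elim: u => //= l u; apply: reduced_push. Qed.

(** A word and its reduction act alike on reduced words by successive pushes; associativity of the
    product follows. *)
Lemma foldr_push_reduce w u : reduced w -> foldr push w (reduce u) = foldr push w u.
Proof.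
move=> red; elim: u => //= l u <-.
case: (reduce u) => [|y x] //=; case: eqP => // -> /=.
by rewrite pushK // reduced_foldr_push.
Qed.

Lemma reduce_cat u v : reduce (u ++ v) = foldr push (reduce v) u.
Proof. exact: foldr_cat. Qed.

Lemma reduce_catl u v : reduce (reduce u ++ v) = reduce (u ++ v).
Proof. by rewrite !reduce_cat foldr_push_reduce // reduced_reduce. Qed.

Lemma reduce_catr u v : reduce (u ++ reduce v) = reduce (u ++ v).
Proof. by rewrite !reduce_cat reduce_id // reduced_reduce. Qed.

Lemma reduce_winv w : reduce (winv w ++ w) = [::].
Proof.
rewrite reduce_cat /winv; elim: w => // l w IHw.
rewrite map_cons rev_cons foldr_rcons -[RHS]IHw /=; congr (foldr _ _ _).
by rewrite -{2}(linvK l) pushK // reduced_reduce.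
Qed.

Lemma F2_is_group : is_group F2.
Proof.
split=> [x y z|x|x]; apply: val_inj; rewrite /=.
- by rewrite reduce_catr reduce_catl catA.
- exact/reduce_id/valP.
- by rewrite reduce_catl reduce_winv.
Qed.

(** [b] is the part of [u] that cancels against [v]; the end of [a] is the centre of the tripod in
    the Cayley tree. *)
Lemma reduced_cat_tripod u v : reduced u -> reduced v ->
  exists a b c, [/\ u = a ++ b, v = winv b ++ c & reduce (u ++ v) = a ++ c].
Proof.
elim: v u => [|l' v IHv] u.
  by move=> red _; exists u, [::], [::]; rewrite !cats0 reduce_id.
case/lastP: u => [|u l] red red'.
  by exists [::], [::], (l' :: v); rewrite /= -[push _ _]/(reduce (l' :: v)) reduce_id.
have [El'|neq] := eqVneq l' (linv l); last first.
  exists (rcons u l), [::], (l' :: v); rewrite cats0 reduce_id //.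
  case: u red => [|y u] /= red; first by rewrite neq.
  by rewrite /reduced /= cat_path last_rcons -/(rcons _ _) red /= neq.
have [||a [b [c [Ea Eb Ec]]]] := IHv u.
- by move: red; rewrite -cats1 /reduced => /cat_sorted2[].
- exact: path_sorted red'.
exists a, (rcons b l), c; split.
- by rewrite Ea rcons_cat.
- by rewrite -cats1 winv_cat /= -El' Eb.
have -> : reduce (rcons u l ++ l' :: v) = reduce (u ++ v).
  rewrite cat_rcons !reduce_cat -(cat1s l) reduce_cat (reduce_id red') /= El' eqxx.
  by rewrite reduce_id //; exact: path_sorted red'.
by [].
Qed.

Definition of_word w : F2 := exist _ (reduce w) (reduced_reduce w).

Lemma of_word_val (g : F2) : of_word (val g) = g.
Proof. exact/val_inj/reduce_id/valP. Qed.

Lemma of_word_cat u v : of_word (u ++ v) = gmul (of_word u) (of_word v).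
Proof. by apply: val_inj; rewrite /= reduce_catr reduce_catl. Qed.

Lemma of_word_winv w : of_word (winv w) = ginv (of_word w).
Proof.
have wv1 : gmul (of_word (winv w)) (of_word w) = gone F2.
  by rewrite -of_word_cat; apply: val_inj; rewrite /= reduce_winv.
by rewrite (ginv_uniq F2_is_group wv1) (ginvK F2_is_group).
Qed.

Fixpoint cayley_path (g : F2) w : seq F2 :=
  g :: (if w is l :: w' then cayley_path (gmul g (of_word [:: l])) w' else [::]).

Lemma cayley_path_cons g l w :
  cayley_path g (l :: w) = g :: cayley_path (gmul g (of_word [:: l])) w.
Proof. by []. Qed.

(** Reading the letter of the edge as [x^-1 y] makes the label invariant under left translation.
    Inverse letters get [Lc], so an edge labelled [La] or [Lb] becomes blank when reversed. *)
Definition edge_lab (J : seq F2) : lab :=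
  if J is [:: x; y] then
    if gmul (ginv x) y == of_word [:: (false, false)] :> F2car then La
    else if gmul (ginv x) y == of_word [:: (true, false)] :> F2car then Lb else Lc
  else Lc.

Definition letter_lab l : lab :=
  if l == (false, false) then La else if l == (true, false) then Lb else Lc.

Lemma wd_cayley_path g w :
  wd xpredT 1 edge_lab (cayley_path g w) = map letter_lab w.
Proof.
elim: w g => // l w IHw g; rewrite map_cons -(IHw (gmul g (of_word [:: l]))).
rewrite {IHw} /wd; set g' := gmul _ _.
rewrite cayley_path_cons -/g'.
rewrite wins_consE; have [r ->] : exists r, cayley_path g' w = g' :: r.
  by case: w => [|l' w]; eexists.
rewrite map_cons /edge_lab /g' (gmulKV F2_is_group); congr (_ :: _).
by case: l {g'} => -[] [].
Qed.

Lemma cayley_path_act g x w :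
  map (gmul g) (cayley_path x w) = cayley_path (gmul g x) w.
Proof.
elim: w x => // l w IHw x.
by rewrite !cayley_path_cons map_cons IHw (gmulA F2_is_group).
Qed.

Lemma cayley_path_cat g u v : exists P c Q,
  [/\ c = gmul g (of_word u), cayley_path g u = rcons P c,
      cayley_path c v = c :: Q & cayley_path g (u ++ v) = P ++ c :: Q].
Proof.
elim: u g => [|l u IHu] g.
  rewrite (_ : of_word [::] = gone F2) ?(gmul1r F2_is_group); last exact: val_inj.
  by exists [::], g; case: v => [|l v]; eexists.
have [P [c [Q []]]] := IHu (gmul g (of_word [:: l])).
rewrite -(gmulA F2_is_group) -of_word_cat => Ec E1 E2 E3.
by exists (g :: P), c, Q; split=> //; rewrite ?cat_cons cayley_path_cons ?E1 ?E3.
Qed.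

Lemma cayley_path_rev g w :
  rev (cayley_path g w) = cayley_path (gmul g (of_word w)) (winv w).
Proof.
elim: w g => [|l w IHw] g.
  by rewrite (_ : of_word [::] = gone F2) ?(gmul1r F2_is_group) //; exact: val_inj.
rewrite cayley_path_cons rev_cons IHw.
rewrite -[l :: w]cat1s winv_cat of_word_cat (gmulA F2_is_group).
set g' := gmul g _.
have [P [c [Q [Ec -> EQ ->]]]] := cayley_path_cat (gmul g' (of_word w)) (winv w) (winv [:: l]).
rewrite -cat_rcons; have -> : Q = [:: g]; last by rewrite cats1.
suff <- : gmul c (of_word (winv [:: l])) = g by move: EQ; rewrite /winv => -[<-].
rewrite Ec !of_word_winv -!(gmulA F2_is_group) (gmulK F2_is_group).
by rewrite (gmulVr F2_is_group) (gmul1r F2_is_group).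
Qed.

(** Every vertex is an orbit point and, with [k = 1], windows are edges. Tripods come from
    cancellation between reduced words; rich elements are positive words, whose inverses have blank
    labels. *)
Lemma F2_path_system : path_system (@gmul F2) xpredT 1 edge_lab
  (fun g => cayley_path (gone F2) (val g)).
Proof.
split=> // [g J||g h|s q s_gt0].
- case: J => [|x [|y [|z J]]] //; rewrite !map_cons /edge_lab.
  by rewrite (ginvM F2_is_group) -!(gmulA F2_is_group) (gmulKV F2_is_group).
- by exists (gone F2).
- have [a [b [c [Ea Eb Ec]]]] := reduced_cat_tripod (valP g) (valP h).
  have [P [x [Q [Ex E1 E2 E3]]]] := cayley_path_cat (gone F2) a b.
  have [P' [x' [R [Ex' E1' E2' E3']]]] := cayley_path_cat (gone F2) a c.
  move: E1'; rewrite E1 => /rcons_inj[EP Exx'].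
  rewrite -{}EP -{}Exx' in E2' E3'.
  have Eg : gmul x (of_word b) = g.
    by rewrite Ex -(gmulA F2_is_group) -of_word_cat -Ea of_word_val (gmul1 F2_is_group).
  exists P, x, Q, R; rewrite -E3 [val (gmul g h)]Ec -E3' -Ea; split=> //.
  rewrite cayley_path_act (gmul1r F2_is_group) Eb.
  have [P2 [x2 [R2 [Ex2 F1 F2 ->]]]] := cayley_path_cat g (winv b) c.
  have Exx2 : x2 = x.
    by rewrite Ex2 -Eg of_word_winv -(gmulA F2_is_group) (gmulVr F2_is_group) (gmul1r F2_is_group).
  move: F2; rewrite Exx2 E2' => -[<-]; rewrite -cat_rcons -Exx2 -F1 -{1}Eg -cayley_path_rev.
  by rewrite E2 rev_cons cat_rcons Exx2.
(* Positive words are reduced. [lt] sends [Lc] to the first generator by default, but is only undone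
   on words without [Lc]. *)
pose lt (x : lab) : letter := (x == Lb, false).
have red (x : seq lab) : reduced (map lt x).
  by case: x => //= y x; elim: x y => //= z x IHx y; rewrite IHx andbT /linv xpair_eqE andbF.
pose w := map lt (u_word (iota s q)).
have Ew : val (of_word w) = w by exact/reduce_id/red.
exists (of_word w); rewrite Ew cayley_path_rev !wd_cayley_path; split.
  rewrite /w -map_comp map_id_in // => x /(allP (all_u_word _)).
  by case: x.
move=> e i _; apply/negP => /prefixP[r Er].
have Ew' : map letter_lab (winv w) = nseq (size w) Lc.
  rewrite /winv map_rev -rev_nseq /w size_map; congr rev.
  by elim: (u_word _) => //= -[] x ->.
have : La \in drop i (map letter_lab (winv w)) by rewrite Er mem_head.
by move/mem_drop; rewrite Ew' mem_nseq andbF.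
Qed.

End FreeGroup.

(** * Geodesics in trees *)

Section TreeGeodesics.
Variables (V : Type) (adj : V -> V -> Prop) (v : V).
Hypothesis tree : is_simplicial_tree adj.
Implicit Types (x y z : V) (l s : seq V).

(** The conditions of [geodesic] stated by position, in which form they pass easily to reversals and
    factors; the empty list is allowed. *)
Definition geo l := forall i,
  (i.+1 < size l -> adj (nth v l i) (nth v l i.+1)) /\
  (i.+2 < size l -> nth v l i.+2 <> nth v l i).

Lemma geo_cons x l : geo (x :: l) <->
  [/\ geo l, 0 < size l -> adj x (nth v l 0) & 1 < size l -> nth v l 1 <> x].
Proof.
split=> [gl|[gl gx gx'] [|i]]; last exact: gl; last by [].
by split; [move=> i; exact: gl i.+1 | case: (gl 0) | case: (gl 0)].
Qed.

Lemma geodesicE l : geodesic adj l <-> 0 < size l /\ geo l.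
Proof.
case: l => [|x s]; first by split=> // -[].
elim: s x => [|y s IHs] x; first by split=> [_|//]; split=> // i; split.
have E : geodesic adj (x :: y :: s) <->
    [/\ geodesic adj (y :: s), adj x y & 0 < size s -> nth v s 0 <> x].
  rewrite /=; case: s {IHs} => [|z s] /=; first by split=> [[[]]|[]].
  by split=> [[[? ?] [? ?]]|[[? ?] ? /(_ isT)]].
split=> [/E[/IHs[_ gl] a b]|[_ /geo_cons[gl /(_ isT) a b]]].
  by split=> //; apply/geo_cons.
by apply/E; split=> //; apply/IHs.
Qed.

Lemma geo_rev l : geo l -> geo (rev l).
Proof.
have [_ [adjC _]] := tree.
move=> gl i; rewrite size_rev; split=> lt_i; rewrite !nth_rev; try lia.
  apply: adjC; have -> : (size l - i.+1)%N = (size l - i.+2).+1 by lia.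
  by apply: (gl _).1; lia.
have -> : (size l - i.+1)%N = (size l - i.+3).+2 by lia.
by move=> E; apply: (gl (size l - i.+3)).2; rewrite ?E //; lia.
Qed.

Lemma geo_sub l1 l2 l3 : geo (l1 ++ l2 ++ l3) -> geo l2.
Proof.
move=> gl i; have Enth j : j < size l2 -> nth v l2 j = nth v (l1 ++ l2 ++ l3) (size l1 + j).
  by move=> lt_j; rewrite nth_cat ltnNge leq_addr addKn nth_cat lt_j.
split=> lt_i; rewrite !Enth ?addnS; try lia.
  by apply: (gl _).1; rewrite !size_cat; lia.
by apply: (gl _).2; rewrite !size_cat; lia.
Qed.

Lemma geo_glue l1 x l2 : geo (rcons l1 x) -> geo (x :: l2) ->
  (0 < size l1 -> 0 < size l2 -> nth v l2 0 <> last v l1) ->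
  geo (l1 ++ x :: l2).
Proof.
move=> g1 g2 turn i.
have E1 j : j <= size l1 -> nth v (l1 ++ x :: l2) j = nth v (rcons l1 x) j.
  by rewrite nth_cat nth_rcons; case: ltngtP => // ->; rewrite subnn.
have E2 j : size l1 <= j -> nth v (l1 ++ x :: l2) j = nth v (x :: l2) (j - size l1).
  by move=> le_j; rewrite nth_cat ltnNge le_j.
rewrite size_cat /=; split=> lt_i.
  have [le_i|lt_i'] := leqP i.+1 (size l1).
    by rewrite !E1 ?(ltnW le_i) //; apply: (g1 i).1; rewrite size_rcons.
  rewrite !E2 ?subSn //; try lia.
  by apply: (g2 _).1 => /=; lia.
have [le_i|lt_i'] := leqP i.+2 (size l1).
  by rewrite !E1 //; try lia; apply: (g1 i).2; rewrite size_rcons.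
have [le_i|lt_i''] := leqP (size l1) i.
  rewrite !E2 //; try lia; rewrite -[i.+2]addn2 -addnBAC // addn2.
  by apply: (g2 _).2 => /=; lia.
have Ei : size l1 = i.+1 by lia.
rewrite E2 ?E1; try lia.
rewrite -[X in _ <> X]/(nth v _ i) nth_rcons Ei ltnS leqnn -[i.+2]addn1 addnC -Ei addnK.
by have := turn; rewrite -nth_last Ei; apply=> //; lia.
Qed.

Lemma geo_adj_path x s : geo (x :: s) -> adj_path adj x s.
Proof.
by move=> gs; have [] := (geodesicE (x :: s)).2 (conj isT gs).
Qed.

Lemma not_NoDup l : ~ List.NoDup l -> exists l1 y l2 l3, l = l1 ++ y :: l2 ++ y :: l3.
Proof.
elim: l => [|x l IHl] dup; first by case: dup; constructor.
have [xl|xl] := pselect (List.In x l).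
  by have [l2 [l3 ->]] := List.in_split _ _ xl; exists [::], x, l2, l3.
have [|l1 [y [l2 [l3 ->]]]] := IHl; first by move=> nd; apply: dup; constructor.
by exists (x :: l1), y, l2, l3.
Qed.

(** A repeated vertex inside gives a shorter closed path. Without one, acyclicity applies, or for
    one or two edges irreflexivity and the absence of backtracking. *)
Lemma geo_not_closed x s : geo (x :: s) -> 0 < size s -> last x s <> x.
Proof.
have [irr [_ [_ acyclic]]] := tree.
have [n le_n] := ubnP (size s); elim: n => // n IHn in x s le_n *.
move=> gs s_gt0 Ex; have [nd|/not_NoDup[l1 [y [l2 [l3 Es]]]]] := pselect (List.NoDup s); last first.
  apply: (IHn y (rcons l2 y)); rewrite ?last_rcons ?size_rcons //.
    by move: le_n; rewrite Es !size_cat /= size_cat /=; lia.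
  by apply: (@geo_sub (x :: l1) _ l3); rewrite /= cat_rcons -Es.
case/lastP: s => [//|s z] in le_n gs s_gt0 Ex nd *.
move: Ex; rewrite last_rcons => Ez; rewrite {z}Ez in le_n gs nd s_gt0.
case: s => [|y [|z s]] in le_n gs s_gt0 nd *.
- by apply: (irr x); have := (gs 0).1 isT.
- by have := (gs 0).2 isT.
apply: (acyclic x [:: y, z & s]) => //.
- apply: (Permutation.Permutation_NoDup _ nd); rewrite -cats1.
  exact/Permutation.Permutation_sym/Permutation.Permutation_cons_append.
- by apply: geo_adj_path; apply: (@geo_sub [::] _ [:: x]); rewrite /= cats1.
have := (gs (size s).+2).1; rewrite /= size_rcons => /(_ (ltnSn _)).
by rewrite -rcons_cons !nth_rcons /= ltnS leqnn ltnn eqxx -last_nth.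
Qed.

(** If the paths part at [x], the first one reversed, followed by the second, is a closed path
    without backtracking. *)
Lemma geo_uniq l l' : geo l -> geo l' -> 0 < size l -> 0 < size l' ->
  head v l = head v l' -> last v l = last v l' -> l = l'.
Proof.
case: l l' => [//|x s] [//|x' s'] /= + + _ _ Exx'; rewrite -{x'}Exx'.
elim: s x s' => [|y s IHs] x [|y' s'] //=.
- by move=> _ gs' Ex; case: (geo_not_closed gs' isT).
- by move=> gs _ Ex; case: (geo_not_closed gs isT).
move=> gs gs' El; have [Ey|neq] := pselect (y = y').
  rewrite -Ey in gs' El *; congr (_ :: _).
  by apply: IHs => //; [case/geo_cons: gs | case/geo_cons: gs'].
have : geo (rev (y :: s) ++ x :: y' :: s').
  apply: geo_glue => //; first by rewrite -rev_cons; exact: geo_rev.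
  by move=> _ _ /=; rewrite rev_cons last_rcons => /esym.
rewrite (lastI y s) rev_rcons cat_cons => /geo_not_closed nc; exfalso; apply: nc.
  by rewrite size_cat addnS.
by rewrite last_cat.
Qed.

Lemma geo_exists x y : exists s, geo (x :: s) /\ last x s = y.
Proof.
have [_ [_ [/(_ x y)[s [path_s <-]] _]]] := tree.
elim: s x path_s => [|z s IHs] x /=; first by exists [::]; split=> // i; split.
case=> adj_xz /IHs[t [gt <-]].
(* If the geodesic from [z] goes straight back to [x], it is cut there; otherwise [x] is put in
   front of it. *)
have [[t' Et]|neq] := pselect (exists t', t = x :: t').
  by exists t'; rewrite Et; split=> //; move: gt; rewrite Et => /geo_cons[].
exists (z :: t); split=> //; apply/geo_cons; split=> //.
by case: t neq {gt} => //= a t neq _ Ea; apply: neq; exists t; rewrite Ea.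
Qed.

Lemma common_prefix x a b : exists D c a' b',
  [/\ x :: a = D ++ c :: a', x :: b = D ++ c :: b' &
      0 < size a' -> 0 < size b' -> nth v b' 0 <> nth v a' 0].
Proof.
elim: a x b => [|y a IHa] x b; first by exists [::], x, [::], b.
case: b => [|z b]; first by exists [::], x, (y :: a), [::].
have [Ey|neq] := pselect (z = y); last by exists [::], x, (y :: a), (z :: b).
have [D [c [a' [b' [Ea Eb turn]]]]] := IHa y b.
by exists (x :: D), c, a', b'; split=> //; rewrite ?Ey /= ?Ea ?Eb.
Qed.

(** The centre ends the common initial part of [rev l1] and [l2]; the two remaining branches glue
    without backtracking, and uniqueness identifies the result with [l3]. *)
Lemma geo_tripod l1 l2 l3 : geo l1 -> geo l2 -> geo l3 ->
  0 < size l1 -> 0 < size l2 -> 0 < size l3 ->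
  last v l1 = head v l2 -> head v l3 = head v l1 -> last v l3 = last v l2 ->
  exists P c Q R, [/\ l1 = P ++ c :: Q, l2 = rev Q ++ c :: R & l3 = P ++ c :: R].
Proof.
move=> g1 g2 g3 s1 s2 s3 E12 E31 E32.
case/lastP: l1 => [//|l1 x] in g1 s1 E12 E31 *.
case: l2 => [//|x' l2] in g2 s2 E12 E32 *.
move: E12; rewrite last_rcons /= => Ex; rewrite -Ex in g2 s2 E32 *.
have [D [c [a [b [Ea Eb turn]]]]] := common_prefix x (rev l1) l2.
have El1 : rcons l1 x = rev a ++ c :: rev D.
  by rewrite -[LHS]revK rev_rcons Ea rev_cat rev_cons cat_rcons.
exists (rev a), c, (rev D), b; rewrite revK; split=> //.
apply: geo_uniq => //.
- apply: geo_glue.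
  + by apply: (@geo_sub [::] _ (rev D)); rewrite cat_rcons -El1.
  + by apply: (@geo_sub D _ [::]); rewrite cats0 -Eb.
  by case: a {Ea El1} turn => // y a turn _; rewrite rev_cons last_rcons; exact: turn.
- by rewrite size_cat addnS.
- by rewrite E31 El1; case: (rev a).
by rewrite E32 Eb !last_cat.
Qed.

End TreeGeodesics.

(** * Groups acting on trees *)

Section OrbitPositions.
Variables (V : Type) (orb : V -> bool) (v : V).
Implicit Types (l J : seq V).

Definition positions J := [seq i <- iota 0 (size J) | orb (nth v J i)].

Lemma positions_cons x J :
  positions (x :: J) = (if orb x then [:: 0] else [::]) ++ map succn (positions J).
Proof.
rewrite /positions /= -[1]addn0 iotaDl filter_map.
by case: (orb x).
Qed.

Lemma size_positions J : size (positions J) = count orb J.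
Proof.
elim: J => // x J IHJ; rewrite positions_cons size_cat size_map IHJ /=.
by case: (orb x).
Qed.

Lemma win_positions k l : k < size (positions l) ->
  win orb k l = Some (take (nth 0 (positions l) k).+1 l).
Proof.
elim: l k => // x l IHl k; rewrite positions_cons /=.
case: (orb x) => /= [|lt_k]; last first.
  by move: lt_k; rewrite size_map => lt_k; rewrite IHl // (nth_map 0).
case: k => [|k]; first by rewrite take0.
by rewrite size_map ltnS => lt_k; rewrite IHl //= (nth_map 0).
Qed.

(** Links [fstar], defined by positions, to the recursive windows. *)
Lemma wins_positions k J :
  [seq take (nth 0 (positions J) (i + k) - nth 0 (positions J) i).+1
         (drop (nth 0 (positions J) i) J) | i <- iota 0 (size (positions J) - k)]
  = wins orb k J.
Proof.
elim: J => // x J IHJ; set s := positions J.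
have Es : [seq take (nth 0 (map succn s) (i + k) - nth 0 (map succn s) i).+1
         (drop (nth 0 (map succn s) i) (x :: J)) | i <- iota 0 (size s - k)] = wins orb k J.
  rewrite -IHJ; apply/eq_in_map => i; rewrite mem_iota => lt_i.
  by rewrite !(nth_map 0) ?subSS //; rewrite -/s; lia.
have Ep := positions_cons x J; have [orbx|norbx] := boolP (orb x); last first.
  by rewrite Ep (negPf norbx) wins_skip //= size_map.
have [le_k|lt_k] := leqP k (size s); last first.
  rewrite wins_nil -?size_positions // Ep orbx /= size_map -/s; last by [].
  by rewrite (_ : _ - _ = 0)%N //; lia.
have Ek : win orb k (x :: J) = Some (take (nth 0 (positions (x :: J)) k).+1 (x :: J)).
  by rewrite win_positions // Ep orbx /= size_map ltnS.
rewrite wins_consE orbx Ek Ep orbx -/s [cat _ _]/= [size _]/= size_map subSn //.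
rewrite [iota _ _]/= map_cons add0n subn0 drop0; congr (_ :: _).
rewrite -[1]addn0 iotaDl -map_comp -Es; apply: eq_map => i /=.
by rewrite add0n.
Qed.

Lemma win_spec k l w : win orb k l = Some w ->
  exists b, [/\ l = w ++ b, count orb w = k.+1 & orb (last v w)].
Proof.
elim: l k w => //= x l IHl k w; case: (boolP (orb x)) => orbx.
  case: k => [|k]; first by case=> <-; exists l; rewrite /= orbx.
  case: (win orb k l) (IHl k) => //= w' /(_ _ erefl)[b [-> cw' ow']] [<-].
  by exists b; rewrite /= orbx cw'; split=> //; case: w' cw' ow'.
case: (win orb k l) (IHl k) => //= w' /(_ _ erefl)[b [-> cw' ow']] [<-].
by exists b; rewrite /= (negPf orbx) cw'; split=> //; case: w' cw' ow'.
Qed.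

End OrbitPositions.

Section TreeAction.
Variables (G : gops) (V : Type) (adj : V -> V -> Prop) (act : G -> V -> V) (v : V).
Hypotheses (gG : is_group G) (tree : is_simplicial_tree adj).
Hypothesis (actG : is_action_without_inversions adj act).
Implicit Types (g h : G) (x y : V) (J : seq V).

Definition in_orbitb x : bool := `[< Defs.in_orbit act v x >].

Local Notation orb := in_orbitb.

Local Notation geo := (geo adj v).
Local Notation translate := (translate act).

Lemma orb_act g x : orb (act g x) = orb x.
Proof.
have [act1 [actM _]] := actG; apply/asboolP/asboolP => -[h Eh].
  by exists (gmul (ginv g) h); rewrite actM Eh -actM (gmulV gG) act1.
by exists (gmul g h); rewrite actM Eh.
Qed.

Lemma act_inj g x y : act g x = act g y -> x = y.
Proof.
have [act1 [actM _]] := actG => /(congr1 (act (ginv g))).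
by rewrite -!actM (gmulV gG) !act1.
Qed.

Lemma geo_translate g J : geo J -> geo (translate g J).
Proof.
have [_ [_ [actE _]]] := actG => gJ i; rewrite size_map.
split=> lt_i; rewrite !(nth_map v); try lia.
  by apply: (actE g _ _).1; apply: (gJ i).1.
by move/act_inj; apply: (gJ i).2.
Qed.

Lemma translateK g J : translate (ginv g) (translate g J) = J.
Proof.
have [act1 [actM _]] := actG.
by rewrite /translate -map_comp -[RHS]map_id; apply: eq_map => x /=; rewrite -actM (gmulV gG).
Qed.

Lemma orbit_pos_positions J s : orbit_pos act v J s -> s = positions orb v J.
Proof.
case=> s_sorted mem_s; apply: (irr_sorted_eq ltn_trans ltnn) => //.
  by rewrite sorted_filter ?iota_ltn_sorted //; exact: ltn_trans.
move=> i; rewrite mem_filter mem_iota /= add0n; apply/idP/andP.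
  by move/mem_s=> [lt_i oi]; split=> //; apply/asboolP.
by case=> /asboolP oi lt_i; apply/mem_s.
Qed.

Lemma o_lengthE J n : o_length act v J n <-> count orb J = n.+1.
Proof.
split=> [[s [/orbit_pos_positions-> <-]]|cJ]; first by rewrite size_positions.
exists (positions orb v J); rewrite size_positions cJ; split=> //; split.
  by rewrite sorted_filter ?iota_ltn_sorted //; exact: ltn_trans.
move=> i; rewrite mem_filter mem_iota /= add0n; split.
  by case/andP=> /asboolP.
by case=> lt_i oi; rewrite lt_i andbT; apply/asboolP.
Qed.

Lemma EE n J : E adj act v n J <->
  [/\ 0 < size J, geo J, orb (head v J), orb (last v J) & count orb J = n.+1].
Proof.
split=> [[[/(geodesicE adj v)[s_gt0 gJ] [/asboolP o1 /asboolP o2]] /o_lengthE c]|].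
  by split.
case=> ? ? /asboolP ? /asboolP ? /o_lengthE ?; split=> //; split=> //.
exact/(geodesicE adj v).
Qed.

Lemma E_translate n g J : E adj act v n (translate g J) <-> E adj act v n J.
Proof.
have imp h J' : E adj act v n J' -> E adj act v n (translate h J').
  case/EE=> s_gt0 gJ o1 o2 c; apply/EE; split.
  - by rewrite size_map.
  - exact: geo_translate.
  - by case: J' s_gt0 o1 {gJ o2 c} => //= x J' _; rewrite orb_act.
  - by case: J' s_gt0 o2 {gJ o1 c} => //= x J' _; rewrite last_map orb_act.
  by rewrite count_map -c; apply: eq_count => x; exact: orb_act.
by split; [move/(imp (ginv g)); rewrite translateK | exact: imp].
Qed.

Lemma E_rev n J : E adj act v n J -> E adj act v n (rev J).
Proof.
case/EE=> s_gt0 gJ o1 o2 c; apply/EE; rewrite size_rev count_rev; split=> //.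
- exact: geo_rev.
- by case/lastP: J s_gt0 o2 {gJ o1 c} => // J x _; rewrite last_rcons rev_rcons.
by case: J s_gt0 o1 {gJ o2 c} => // x J _; rewrite rev_cons last_rcons.
Qed.

(** * Good labellings and reversal of orientation *)

Section Labelling.
Variables (k : nat) (f : seq V -> lab).
Hypothesis good : good_labelling adj act v k f.

(* [f] is only known to be [G]-invariant on [E k]. *)
Definition ext_lab J : lab := if `[< E adj act v k J >] then f J else Lc.

Lemma ext_labE J : E adj act v k J -> ext_lab J = f J.
Proof. by rewrite /ext_lab; case: asboolP. Qed.

Lemma ext_lab_E J : ext_lab J != Lc -> E adj act v k J.
Proof. by rewrite /ext_lab; case: asboolP. Qed.

Lemma ext_lab_translate g J : ext_lab (translate g J) = ext_lab J.
Proof.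
rewrite /ext_lab; case: asboolP => [/E_translate EJ|nEJ].
  by rewrite asboolT //; case: good => -[_ ->].
by rewrite asboolF // => EJ; apply: nEJ; exact/E_translate.
Qed.

Definition swap_lab (x : lab) := match x with La => Lb | Lb => La | Lc => Lc end.

(** If some [J0] labelled [La] has its reversal labelled [Lb], the labelling is good by single
    orbits, and translation carries the swap from [J0] to the others. If there is none, a label and
    its reversal agree when neither is [Lc]. *)
Lemma ext_lab_rev : exists2 phi, phi = id \/ phi = swap_lab &
  forall J, ext_lab J != Lc -> ext_lab (rev J) != Lc ->
    ext_lab J = phi (ext_lab (rev J)).
Proof.
have [[J0 EJ0 [fJ0 fJ0r]]|no_ab] :=
  pselect (exists2 J, E adj act v k J & f J = La /\ f (rev J) = Lb).
  exists swap_lab; first by right.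
  have [[[Ja [_ [_ Ha]]] [Jb [_ [_ Hb]]]]|/(_ _ EJ0 fJ0)//] := good.2.2.2.
  have rev_tr g J : ext_lab (rev (translate g J)) = ext_lab (rev J).
    by rewrite /translate -map_rev ext_lab_translate.
  have EJ0r := E_rev EJ0.
  move=> J nJ nJr; have EJ := ext_lab_E nJ; move: nJ nJr; rewrite (ext_labE EJ).
  case fJ: (f J) => // _ _.
    have [g Eg] := Ha _ EJ fJ; have [h Eh] := Ha _ EJ0 fJ0.
    by rewrite Eg rev_tr -(rev_tr h) -Eh ext_labE // fJ0r.
  have [g Eg] := Hb _ EJ fJ; have [h Eh] := Hb _ EJ0r fJ0r.
  by rewrite Eg rev_tr -(rev_tr h) -Eh revK ext_labE // fJ0.
exists id; first by left.
move=> J nJ nJr; have EJ := ext_lab_E nJ; have EJr := ext_lab_E nJr.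
move: nJ nJr; rewrite !ext_labE //; case fJ: (f J); case fJr: (f (rev J)) => // _ _.
  by case: no_ab; exists J.
by case: no_ab; exists (rev J); rewrite ?revK.
Qed.

Lemma wd_ext_lab J : geo J -> wd orb k ext_lab J = map f (wins orb k J).
Proof.
rewrite /wd; elim: J => // x J IHJ gJ; have gJ' : geo J by case/geo_cons: gJ.
rewrite wins_consE; case: ifP => orbx; last exact: IHJ.
case Ew: win => [w|] //; rewrite !map_cons IHJ // ext_labE //.
have [b [Eb cw ow]] := win_spec v Ew; apply/EE; split=> //.
- by case: w cw {Ew ow Eb}.
- by apply: (@geo_sub _ _ _ [::] _ b); rewrite -Eb.
by case: w cw Eb {Ew ow} => // y w _ [<-].
Qed.

Lemma fstar_wd J w : geo J -> fstar act v k f J w -> wd orb k ext_lab J = w.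
Proof.
move=> gJ [s [/orbit_pos_positions-> ->]].
by rewrite wd_ext_lab // -(wins_positions _ v) -map_comp.
Qed.

(** A mark along the reversal, read backwards and relabelled by [phi], would put the reversed mark
    in the increasing word, with its letters exchanged if [phi] is [swap_lab]. *)
Lemma no_reverse_mark J s q e i : 0 < s -> 0 < e ->
  wd orb k ext_lab J = u_word (iota s q) ->
  ~~ prefix (mark e) (drop i (wd orb k ext_lab (rev J))).
Proof.
move=> s_gt0 e_gt0 EJ; apply/negP; rewrite /wd wins_rev map_rev -map_comp.
move=> /prefixP[r Er]; set ws := wins orb k J in Er; set b := ext_lab \o rev in Er.
have Eb : map b ws = rev r ++ rev (mark e) ++ rev (take i (rev (map b ws))).
  by rewrite -[LHS]revK -{1}(cat_take_drop i (rev (map b ws))) Er !rev_cat catA.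
have pr : prefix (rev (mark e)) (map b (drop (size r) ws)).
  by rewrite map_drop Eb drop_size_cat ?size_rev // prefix_prefix.
have [phi phiE Hphi] := ext_lab_rev.
have /(prefix_map_rel (phi := phi) (a := ext_lab) (c := Lc) pr) :
    all (predC1 Lc) (rev (mark e)).
  by rewrite all_rev /= all_cat /= !all_nseq all_cat all_nseq /= !orbT.
rewrite map_drop -/(wd orb k ext_lab J) EJ => /(_ _ Hphi).
have /[swap]/[apply] : all (predC1 Lc) (drop (size r) (u_word (iota s q))).
  by apply/allP => x /mem_drop /(allP (all_u_word _)).
case: phiE => ->; first by rewrite map_id; apply/negP/rev_mark_u_word.
(* Here the first run of the swapped word consists of at least two [La], the exponent being
   positive; [(size r).+1] skips the leading [Lb]. *)
rewrite rev_mark; case: e e_gt0 {Er Eb pr} => // e _ /prefixP[r' Er'].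
have /negP := LaLa_u_word q (size r).+1 s_gt0; apply.
by rewrite -add1n -drop_drop Er' /= ?drop0 ?prefix0s.
Qed.

End Labelling.

(** Paths are the geodesics from [v]. A rich [J] joins [g v] to [h v], so its translate by the
    inverse of [g] is the path of [g^-1 h]. *)
Lemma tree_path_system k f :
  good_labelling adj act v k f ->
  (forall e : seq nat, all (fun n => 0 < n) e -> exists J N,
     E adj act v N J /\ k <= N /\ fstar act v k f J (u_word e)) ->
  exists path, path_system act in_orbitb k (ext_lab k f) path.
Proof.
move=> good rich; have [act1 [actM [actE _]]] := actG.
have [t tP] := choice (fun g => geo_exists v tree v (act g v)).
exists (fun g => v :: t g); split.
- exact: orb_act.
- exact: ext_lab_translate.
- exists v; have [gt Et] := tP (gone G); case: (t _) gt Et => // y l gt Et.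
  by case: (geo_not_closed tree gt isT); rewrite Et act1.
- move=> g h; have [[gg Eg] [gh Eh] [ggh Egh]] := And3 (tP g) (tP h) (tP (gmul g h)).
  apply: (geo_tripod tree gg _ ggh) => //; first exact: (geo_translate g gh).
  by rewrite /= last_map Eh Egh actM.
move=> s q s_gt0; have [|J [N [/EE[J_gt0 gJ og oh _] [_ Jf]]]] := rich (iota s q).
  by apply/allP => n; rewrite mem_iota => /andP[/(leq_trans s_gt0)].
move: og oh => /asboolP[g Eg] /asboolP[h Eh].
have EJ : wd orb k (ext_lab k f) J = u_word (iota s q) by exact: fstar_wd.
exists (gmul (ginv g) h); have [gx Ex] := tP (gmul (ginv g) h).
have -> : v :: t (gmul (ginv g) h) = translate (ginv g) J.
  apply: (geo_uniq tree) => //; first exact: geo_translate.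
  - by rewrite size_map.
  - by case: J J_gt0 Eg {gJ Eh Jf EJ} => //= x J _ <-; rewrite -actM (gmulV gG) act1.
  by rewrite /= Ex actM Eh; case: J J_gt0 {gJ Eg Eh Jf EJ} => //= x J _; rewrite last_map.
have wdE l : wd orb k (ext_lab k f) (translate (ginv g) l) = wd orb k (ext_lab k f) l.
  by apply: wd_map; [exact: orb_act | exact: ext_lab_translate].
rewrite /translate -map_rev !wdE; split=> // e i e_gt0.
exact: no_reverse_mark EJ.
Qed.

End TreeAction.

Theorem theoremA (G : gops) (V : Type) (adj : V -> V -> Prop) (act : G -> V -> V) :
  is_group G ->
  is_simplicial_tree adj ->
  is_action_without_inversions adj act ->
  weakly_acylindrical adj act ->
  trivial_positive_theory G.
Proof.
move=> gG tree actG [_ [_ [v [k [f [good rich]]]]]] p _.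
have [path ps] := tree_path_system gG tree actG good rich.
(* The path system lives on the side where truth is assumed: the given tree for this inclusion, the
   Cayley tree of [F2] for the converse. *)
split; first exact: (holds_transfer gG ps F2_is_group).
exact: (holds_transfer F2_is_group F2_path_system gG).
Qed.
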